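(* Assume that $-\infty<\underline{\mathrm{E}}^{\infty}\big(\inf_{t\in T}f_t\circ X_1\big)$. Then for every integer $n\geq 2$, $$\underline{\mathrm{E}}^{\infty}\big(\hat{\underline{\mathrm{E}}}_{n-1}(f)\big)\leqslant\underline{\mathrm{E}}^{\infty}\big(\hat{\underline{\mathrm{E}}}_{n}(f)\big)\leqslant\overline{\mathrm{E}}^{\infty}\big(\hat{\underline{\mathrm{E}}}_{n}(f)\big)\leqslant\underline{\mathrm{E}}^{\mathscr{P}}(f).$$
   Context: Setting. $\mathscr{B}$ is the Borel $\sigma$-field on $\mathbb{R}$. $T$ is a non-empty index set (with no further structure), $\mathscr{P}=\{P_t : t\in T\}$ is a set of probability measures on $(\mathbb{R},\mathscr{B})$, and $P$ is a probability measure on $(\mathbb{R},\mathscr{B})$, not necessarily in $\mathscr{P}$. For a probability measure $Q$, $\mathrm{E}^Q(h)=\int h\,\mathrm{d}Q$. The map $f\colon\mathbb{R}\to\mathbb{R}$ is Borel measurable with $\sup_{t\in T}\mathrm{E}^{P_t}(|f|)<+\infty$, and $\underline{\mathrm{E}}^{\mathscr{P}}(f):=\inf_{t\in T}\mathrm{E}^{P_t}(f)$. For each $t\in T$, $f_t\colon\mathbb{R}\to\mathbb{R}$ is a Borel measurable map with $\mathrm{E}^P(f_t)=\mathrm{E}^{P_t}(f)$ and $\mathrm{E}^P(|f_t|)=\mathrm{E}^{P_t}(|f|)$ (so each $f_t$ is $P$-integrable). Sampling. $(\mathbb{R}^\infty,\mathscr{B}^\infty,P^\infty)$ is the countably infinite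 product of copies of $(\mathbb{R},\mathscr{B},P)$, $X_k\colon\mathbb{R}^\infty\to\mathbb{R}$ is the $k$-th coordinate projection ($k\ge 1$), and $\mathrm{E}^\infty$ is the expectation with respect to $P^\infty$. For $n\geq1$, the estimator is the (not necessarily measurable) map $$\hat{\underline{\mathrm{E}}}_n(f):=\inf_{t\in T}\frac1n\sum_{k=1}^n f_t(X_k)\colon\mathbb{R}^\infty\to\mathbb{R}\cup\{-\infty,+\infty\}.$$ Outer and inner expectations. For an arbitrary map $h\colon\mathbb{R}^\infty\to\overline{\mathbb{R}}:=\mathbb{R}\cup\{-\infty,+\infty\}$, $$\overline{\mathrm{E}}^{\infty}(h):=\inf\{\mathrm{E}^\infty(g) : g\colon\mathbb{R}^\infty\to\overline{\mathbb{R}}\text{ measurable},\ h\leqslant g,\ \mathrm{E}^\infty(g)\text{ exists}\},\qquad \underline{\mathrm{E}}^{\infty}(h):=-\overline{\mathrm{E}}^{\infty}(-h),$$ where ''$\mathrm{E}^\infty(g)$ exists'' means that at least one of $\mathrm{E}^\infty(\max\{g,0\})$ and $\mathrm{E}^\infty(\max\{-g,0\})$ is finite. *)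

(* Defs.v *)
From HB Require Import structures.
From mathcomp Require Import all_boot all_order all_algebra.
From mathcomp Require Import all_classical all_reals all_analysis.
From mathcomp Require Import measurable_realfun.

Set Implicit Arguments.
Unset Strict Implicit.
Unset Printing Implicit Defensive.
Import Order.TTheory GRing.Theory Num.Theory.

Local Open Scope classical_set_scope.
Local Open Scope ring_scope.
Local Open Scope ereal_scope.

Definition seq_space (R : realType) : Type := nat -> R.

HB.instance Definition _ (R : realType) := gen_eqMixin (seq_space R).
HB.instance Definition _ (R : realType) := gen_choiceMixin (seq_space R).
HB.instance Definition _ (R : realType) :=
  isPointed.Build (seq_space R) (fun=> 0%R).

(* Coordinates are numbered from 1: [coordinate k] reads the entry of index
   k - 1, so [coordinate 0] coincides with [coordinate 1]. *)
Definition coordinate (R : realType) (k : nat) (w : seq_space R) : R := w k.-1.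

Definition coordinate_preimages (R : realType) : set (set (seq_space R)) :=
  [set B | exists k : nat, exists2 A : set R,
     measurable A & B = @coordinate R k @^-1` A].

(* The product of the Borel sigma-fields. *)
HB.instance Definition _ (R : realType) :=
  Measurable.copy (seq_space R) (g_sigma_algebraType (@coordinate_preimages R)).

(* The library has no infinite product measure. Its values on measurable
   boxes, with finitely many constrained sides, determine it, since the
   boxes form a pi-system that generates the product sigma-field. *)
Definition is_infinite_product (R : realType) (P : probability R R)
    (Pinf : probability (seq_space R) R) : Prop :=
  forall (n : nat) (A : nat -> set R), (forall k, measurable (A k)) ->
    Pinf [set w | forall k, (1 <= k <= n)%N -> A k (coordinate k w)] =
    \prod_(1 <= k < n.+1) P (A k).

Definition expectation_exists d (T : measurableType d) (R : realType)
    (Q : probability T R) (g : T -> \bar R) : Prop :=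
  \int[Q]_w (g^\+ w) < +oo \/ \int[Q]_w (g^\- w) < +oo.

Definition outer_expectation d (T : measurableType d) (R : realType)
    (Q : probability T R) (h : T -> \bar R) : \bar R :=
  ereal_inf [set \int[Q]_w g w | g in
    [set g : T -> \bar R | [/\ measurable_fun [set: T] g,
       forall w, h w <= g w & expectation_exists Q g]]].

Definition inner_expectation d (T : measurableType d) (R : realType)
    (Q : probability T R) (h : T -> \bar R) : \bar R :=
  - outer_expectation Q (fun w => - h w).

Definition lower_expectation (R : realType) (T : Type)
    (Pt : T -> probability R R) (f : R -> R) : \bar R :=
  ereal_inf [set 'E_(Pt t)[f] | t in [set: T]].

Definition estimator (R : realType) (T : Type) (ft : T -> R -> R) (n : nat)
    (w : seq_space R) : \bar R :=
  ereal_inf [set (n%:R^-1 * \sum_(1 <= k < n.+1) ft t (coordinate k w))%R%:E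
            | t in [set: T]].

(* Main.v *)
(* Deleting the i-th observation preserves the product measure, and the mean of
   n observations is the average of its n leave-one-out means. Hence if g is a
   measurable majorant of minus the estimator of order n - 1, averaging g over
   the n deletions gives a measurable majorant of minus the estimator of order n
   with the same expectation, which is the first inequality. For the last one,
   each sample mean of f_t majorizes the estimator and has expectation E^{P_t} f. *)

Require Import Defs.
From HB Require Import structures.
From mathcomp Require Import all_boot all_order all_algebra.
From mathcomp Require Import all_classical all_reals all_analysis.
From mathcomp Require Import measurable_realfun.

Set Implicit Arguments.
Unset Strict Implicit.
Unset Printing Implicit Defensive.
Import Order.TTheory GRing.Theory Num.Theory.

Local Open Scope classical_set_scope.
Local Open Scope ring_scope.
Local Open Scope ereal_scope.

(** * Change of variables, and comparison of inner with outer expectation *)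

Lemma integral_comp_preserving d1 d2 (X : measurableType d1)
    (Y : measurableType d2) (R : realType) (mu : {measure set X -> \bar R})
    (nu : {measure set Y -> \bar R}) (phi : X -> Y) (g : Y -> \bar R) :
  measurable_fun [set: X] phi ->
  (forall A, measurable A -> mu (phi @^-1` A) = nu A) ->
  measurable_fun [set: Y] g ->
  \int[mu]_x g (phi x) = \int[nu]_y g y.
Proof.
move=> mphi pres.
have ge0 (h : Y -> \bar R) : measurable_fun [set: Y] h -> (forall y, 0 <= h y) ->
    \int[mu]_x h (phi x) = \int[nu]_y h y.
  move=> mh h0; rewrite -[LHS](ge0_integral_pushforward mphi mu measurableT mh).
    by apply: eq_measure_integral => A mA _; exact: pres.
  by move=> y _; exact: h0.
move=> mg; rewrite integralE [RHS]integralE; congr (_ - _).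
  by rewrite (funepos_comp g phi) -ge0 //; exact: measurable_funepos.
by rewrite (funeneg_comp g phi) -ge0 //; exact: measurable_funeneg.
Qed.

(** If [g] majorizes [h] and [k] majorizes [- h], then [- k <= g] pointwise. Hence [k^- <= g^+] and
    [g^- <= k^+], and integrating the parts separately compares the two expectations. *)
Lemma inner_le_outer_expectation d (T : measurableType d) (R : realType)
    (Q : probability T R) (h : T -> \bar R) :
  inner_expectation Q h <= outer_expectation Q h.
Proof.
apply: le_ereal_inf_tmp => _ [g [mg hg eg] <-].
rewrite /inner_expectation leeNl; apply: le_ereal_inf_tmp => _ [k [mk hk _] <-].
have kg w : - k w <= g w by rewrite (le_trans _ (hg w))// leeNl.
have kpos : \int[Q]_w k^\- w <= \int[Q]_w g^\+ w.
  apply: ge0_le_integral => //; [exact: measurable_funeneg|exact: measurable_funepos|].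
  by move=> w _; rewrite funenegE funeposE ge_max !le_max lexx kg orbT.
have kneg : \int[Q]_w g^\- w <= \int[Q]_w k^\+ w.
  apply: ge0_le_integral => //; [exact: measurable_funeneg|exact: measurable_funepos|].
  by move=> w _; rewrite funenegE funeposE ge_max !le_max lexx leeNl kg orbT.
(* Distributing the sign over the two parts of [g] requires that their difference is not oo - oo,
   which is the existence of its expectation. *)
rewrite integralE [in leRHS]integralE oppeB; last first.
  have pos0 : 0 <= \int[Q]_w g^\+ w by exact: integral_ge0.
  have neg0 : 0 <= \int[Q]_w g^\- w by exact: integral_ge0.
  by case: eg => [|] /lt_eqF ; move: pos0 neg0;
    case: (\int[Q]_w g^\+ w) => [x| |]; case: (\int[Q]_w g^\- w) => [y| |].
by rewrite [leLHS]addeC leeB.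
Qed.

(** * Deleting one observation preserves the product measure *)

Definition skip (R : realType) (i : nat) (w : seq_space R) : seq_space R :=
  fun k => w (bump i k).

Lemma measurable_coordinate (R : realType) k :
  measurable_fun [set: seq_space R] (@coordinate R k).
Proof.
move=> _ A mA; rewrite setTI; apply: sub_sigma_algebra.
by exists k, A.
Qed.

Lemma measurable_skip (R : realType) i :
  measurable_fun [set: seq_space R] (@skip R i).
Proof.
apply: (@measurability _ _ _ _ _ _ (@coordinate_preimages R)) => //.
move=> _ [_ [k [A mA ->]] <-].
rewrite setTI; apply: sub_sigma_algebra.
by exists (bump i k.-1).+1, A.
Qed.

(** The boxes of [is_infinite_product] with sides numbered from 0, so that [bump i] acts directly on
    the side indices. *)
Definition box (R : realType) (n : nat) (A : nat -> set R) : set (seq_space R) :=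
  [set w | forall k, (k < n)%N -> A k (w k)].

Lemma measurable_box (R : realType) n (A : nat -> set R) :
  (forall k, measurable (A k)) -> measurable (box n A).
Proof.
move=> mA.
rewrite [X in measurable X](_ : _ = \bigcap_(k < n) (coordinate k.+1 @^-1` A k)).
  apply: bigcap_measurableType => k _; rewrite -[X in measurable X]setTI;
    exact: measurable_coordinate.
by apply/seteqP; split => w wA k /wA.
Qed.

Lemma measure_box (R : realType) (P : probability R R)
    (Pinf : probability (seq_space R) R) n (A : nat -> set R) :
  is_infinite_product P Pinf -> (forall k, measurable (A k)) ->
  Pinf (box n A) = \prod_(k < n) P (A k).
Proof.
move=> prod mA; have := prod n (fun k => A k.-1) (fun k => mA k.-1).
rewrite big_add1 /= big_mkord => <-; congr (Pinf _).
apply/seteqP; split => w wA k.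
  by case: k => // k /wA.
by move=> kn; exact: (wA k.+1).
Qed.

(** For [i <= n] the preimage is the box with a full side inserted at index [i], which contributes a
    factor 1. For [n < i] the deletion does not touch the first [n] entries. *)
Lemma measure_preimage_skip_box (R : realType) (P : probability R R)
    (Pinf : probability (seq_space R) R) i n (A : nat -> set R) :
  is_infinite_product P Pinf -> (forall k, measurable (A k)) ->
  Pinf (skip i @^-1` box n A) = Pinf (box n A).
Proof.
move=> prod mA; have [ilen|nlti] := leqP i n.
  pose A' k := if k == i then setT else A (unbump i k).
  have mA' k : measurable (A' k) by rewrite /A'; case: ifP.
  have -> : skip i @^-1` box n A = box n.+1 A'.
    apply/seteqP; split=> w /= wA k kn.
      rewrite /A'; case: ifPn => // ki.
      have := wA (unbump i k); rewrite /skip unbumpK//; apply.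
      rewrite /unbump; have [lt_ki|lt_ik|eq_ki] := ltngtP k i.
      - by rewrite subn0 (leq_trans lt_ki).
      - by rewrite subn1 -ltnS (ltn_predK lt_ik).
      - by rewrite eq_ki eqxx in ki.
    have := wA (bump i k); rewrite /A' eq_sym (negbTE (neq_bump i k)) bumpK; apply.
    by rewrite /bump ltnS (leq_trans _ kn)// -[leqRHS]add1n leq_add2r leq_b1.
  (* The factor of index [i] is split off; [bump i] reindexes the others. *)
  rewrite !(measure_box _ prod)// (bigD1_ord (Ordinal (ilen : (i < n.+1)%N)))//=.
  rewrite {1}/A' eqxx probability_setT mul1e; apply: eq_bigr => k _.
  by rewrite /A' eq_sym (negbTE (neq_bump i k)) bumpK.
congr (Pinf _); apply/seteqP; split=> w /= wA k kn; have := wA k kn;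
  by rewrite /skip /bump leqNgt (ltn_trans kn nlti).
Qed.

(** The pushforward of [Pinf] by [skip i] and [Pinf] itself agree on boxes, a generating pi-system,
    hence everywhere. *)
Lemma measure_preimage_skip (R : realType) (P : probability R R)
    (Pinf : probability (seq_space R) R) i (B : set (seq_space R)) :
  is_infinite_product P Pinf -> measurable B ->
  Pinf (skip i @^-1` B) = Pinf B.
Proof.
move=> prod.
pose G : set (set (seq_space R)) :=
  [set B | exists n A, (forall k, measurable (A k)) /\ B = box n A].
have Gbox n A : (forall k, measurable (A k)) -> G (box n A) by exists n, A.
apply: (measure_unique G (fun=> setT) _ _ _ _
  (pushforward Pinf (@skip R i)) Pinf) => //.
- apply/seteqP; split.
    apply: smallest_sub; first exact: smallest_sigma_algebra.
    move=> _ [k [A mA ->]]; apply: sub_sigma_algebra.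
    (* A coordinate preimage is a box whose last side alone is constrained. *)
    exists k.-1.+1, (fun j => if j == k.-1 then A else setT); split.
      by move=> j; case: ifP.
    apply/seteqP; split => w /=; first by move=> wA j _; case: ifPn => // /eqP ->.
    by move=> /(_ k.-1); rewrite eqxx; apply.
  apply: smallest_sub; first exact: sigma_algebra_measurable.
  by move=> _ [n [A [mA ->]]]; exact: measurable_box.
- move=> _ _ [n [A [mA ->]]] [m [B' [mB ->]]].
  (* The shorter box is padded with full sides before intersecting. *)
  exists (maxn n m), (fun k => (if (k < n)%N then A k else setT) `&`
                              (if (k < m)%N then B' k else setT)); split.
    by move=> k; apply: measurableI; case: ifP.
  apply/seteqP; split => w /=.
    by move=> [wA wB] k _; split; case: ifP => // ?; [exact: wA|exact: wB].
  move=> wAB; split => k kn; have := wAB k; rewrite kn leq_max kn ?orbT.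
    by case.
  by case.
- move=> _; have -> : [set: seq_space R] = box 0 (fun=> setT) by apply/seteqP; split.
  exact: Gbox.
- by apply/seteqP; split => // w _; exists 0%N.
- exact: measurable_skip.
- by move=> mskip _ [n [A [mA ->]]]; exact: measure_preimage_skip_box prod _.
- by move=> mskip k; rewrite /= /pushforward preimage_setT probability_setT ltry.
Qed.

(** * Expectations of sample means *)

Lemma measure_preimage_coordinate (R : realType) (P : probability R R)
    (Pinf : probability (seq_space R) R) k (A : set R) :
  is_infinite_product P Pinf -> measurable A ->
  Pinf (coordinate k @^-1` A) = P A.
Proof.
move=> prod mA; pose B j := if j == k.-1 then A else setT.
have -> : coordinate k @^-1` A = box k.-1.+1 B.
  apply/seteqP; split => w /=; first by rewrite /B => wA j _; case: ifPn => // /eqP ->.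
  by move=> /(_ k.-1); rewrite /B eqxx; apply.
rewrite (measure_box _ prod) => [|j]; last by rewrite /B; case: ifP.
rewrite big_ord_recr big1/=; first by rewrite /B eqxx mul1e.
by move=> j _; rewrite /B ltn_eqF// probability_setT.
Qed.

Section averages.
Context (R : realType) (P : probability R R) (Pinf : probability (seq_space R) R)
  (prod : is_infinite_product P Pinf).

Lemma integrable_coordinate (f : R -> R) k :
  P.-integrable setT (EFin \o f) ->
  Pinf.-integrable setT (fun w => (f (coordinate k w))%:E).
Proof.
move=> /integrableP[mf finf]; apply/integrableP; split.
  exact: (measurableT_comp mf (@measurable_coordinate R k)).
rewrite -[X in X < _](integral_comp_preserving (measurable_coordinate k)
  (fun A => measure_preimage_coordinate k prod)) // in finf.
exact: measurableT_comp.
Qed.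

Definition sample_mean (f : R -> R) n (w : seq_space R) : R :=
  (n%:R^-1 * \sum_(1 <= k < n.+1) f (coordinate k w))%R.

Lemma sample_meanE (f : R -> R) n w :
  sample_mean f n w = (n%:R^-1 * \sum_(k < n) f (w k))%R.
Proof. by rewrite /sample_mean big_add1 big_mkord. Qed.

Lemma EFin_sample_mean (f : R -> R) n w :
  (sample_mean f n w)%:E =
  (n%:R^-1)%:E * \sum_(k <- index_iota 1 n.+1) (f (coordinate k w))%:E.
Proof. by rewrite /sample_mean EFinM sumEFin. Qed.

Lemma integrable_sample_mean (f : R -> R) n :
  P.-integrable setT (EFin \o f) ->
  Pinf.-integrable setT (EFin \o sample_mean f n).
Proof.
move=> intf; apply: eq_integrable (integrableZl measurableT (n%:R^-1)%R
  (integrable_sum measurableT (index_iota 1 n.+1)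
    (fun k _ => integrable_coordinate k intf))) => //.
by move=> w _; rewrite /= EFin_sample_mean.
Qed.

Lemma integral_sample_mean (f : R -> R) n : (0 < n)%N ->
  P.-integrable setT (EFin \o f) ->
  \int[Pinf]_w (sample_mean f n w)%:E = 'E_P[f].
Proof.
move=> n0 intf; under eq_integral do rewrite EFin_sample_mean.
rewrite integralZl//; last first.
  by apply: integrable_sum => // k _; exact: integrable_coordinate.
rewrite integral_sum//; last by move=> k; exact: integrable_coordinate.
have intE k : \int[Pinf]_w (f (coordinate k w))%:E = 'E_P[f].
  rewrite unlock -(integral_comp_preserving (measurable_coordinate k)
    (fun A => measure_preimage_coordinate k prod))//.
  exact: measurable_int intf.
under eq_bigr do rewrite intE.
have : 'E_P[f] \is a fin_num by rewrite unlock; exact: integrable_fin_num.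
move=> /fineK <-; rewrite sumEFin -EFinM sumr_const_nat subSS subn0.
by rewrite -[X in (_ * X)%R]mulr_natl mulrA mulVf ?mul1r// pnatr_eq0 -lt0n.
Qed.

(** Each observation survives in [n - 1] of the [n] deletions, so the leave-one-out sums add up to
    [n - 1] times the full sum; [2 <= n] allows dividing by [n - 1]. *)
Lemma mean_sample_mean_skip (f : R -> R) n w : (2 <= n)%N ->
  (n%:R^-1 * \sum_(i < n) sample_mean f n.-1 (skip i w))%R = sample_mean f n w.
Proof.
move=> n2; rewrite sample_meanE; congr (_ * _)%R.
under eq_bigr do rewrite sample_meanE.
rewrite -mulr_sumr; set S := (\sum_(k < n) f (w k))%R.
have E (i : 'I_n) : (\sum_(k < n.-1) f (skip i w k) = S - f (w i))%R.
  by rewrite /S (bigD1_ord i)//= [RHS]addrC addKr.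
under eq_bigr do rewrite E.
rewrite sumrB sumr_const card_ord -/S -[X in (_ - X)%R]mulr1n -mulrnBr; last exact: ltnW.
rewrite subn1 -[X in (_ * X)%R]mulr_natl mulrA mulVf ?mul1r// pnatr_eq0 -lt0n.
by case: n n2 {S E} => [|[]].
Qed.

(** * The bounds on the estimator *)

Lemma outer_estimator_le (T : Type) (ft : T -> R -> R) n t : (0 < n)%N ->
  P.-integrable setT (EFin \o ft t) ->
  outer_expectation Pinf (estimator ft n) <= 'E_P[ft t].
Proof.
move=> n0 intf; rewrite -(integral_sample_mean n0 intf).
have ints := integrable_sample_mean n intf.
apply: ereal_inf_lbound; exists (EFin \o sample_mean (ft t) n) => //; split.
- exact: measurable_int ints.
- by move=> w; apply: ereal_inf_lbound; exists t.
- by left; exact: integral_funepos_lt_pinfty.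
Qed.

Lemma inner_estimator_nondecreasing (T : Type) (ft : T -> R -> R) n t :
  (2 <= n)%N -> P.-integrable setT (EFin \o ft t) ->
  inner_expectation Pinf (estimator ft n.-1) <=
  inner_expectation Pinf (estimator ft n).
Proof.
move=> n2 intf; have n0 : (0 < n)%N by exact: ltnW.
rewrite leeN2; apply: le_ereal_inf_tmp => _ [g [mg hg _] <-].
have ints := integrable_sample_mean n.-1 intf.
have gN s w : - (sample_mean (ft s) n.-1 w)%:E <= g w.
  by rewrite (le_trans _ (hg w))// leeN2; apply: ereal_inf_lbound; exists s.
(* The integrable sample mean of [ft t] bounds [g^\-] from above, through its positive part. *)
have gneg : \int[Pinf]_w g^\- w < +oo.
  apply: le_lt_trans (integral_funepos_lt_pinfty measurableT ints).
  apply: ge0_le_integral => //; first exact: measurable_funeneg.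
    by apply: measurable_funepos; exact: measurable_int ints.
  by move=> w _; rewrite funenegE funeposE ge_max !le_max lexx leeNl gN orbT.
(* An infinite integral bounds everything. Otherwise [g] is integrable, so the integral of the
   average over deletions can be taken term by term. *)
have [->|gfin] := eqVneq (\int[Pinf]_w g w) +oo; first exact: leey.
have gpos : \int[Pinf]_w g^\+ w < +oo.
  rewrite ltey; apply: contra_neq gfin => gpos.
  rewrite integralE gpos addye// -ltNye -[-oo]oppeK.
  by rewrite lteN2.
have gint : Pinf.-integrable setT g.
  apply/integrableP; split => //.
  rewrite -[X in X < _]/(\int[Pinf]_w (abse \o g) w) fune_abse.
  rewrite ge0_integralD//; first exact: lte_add_pinfty.
  - exact: measurable_funepos.
  - exact: measurable_funeneg.
have gskip_int i : Pinf.-integrable setT (g \o skip i).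
  apply/integrableP; split; first exact: measurableT_comp mg (measurable_skip i).
  rewrite (integral_comp_preserving (g := abse \o g) (measurable_skip i)
    (fun A => measure_preimage_skip i prod)); last exact: measurableT_comp.
  by move/integrableP : gint => [].
pose G w := (n%:R^-1)%:E * \sum_(i < n) g (skip i w).
have Gint : Pinf.-integrable setT G.
  by apply: integrableZl => //; apply: integrable_sum => // i _; exact: gskip_int.
(* By invariance each of the [n] terms integrates to the integral of [g], and the factor [1/n]
   cancels their number. *)
have <- : \int[Pinf]_w G w = \int[Pinf]_w g w.
  rewrite integralZl//; last by apply: integrable_sum => // i _; exact: gskip_int.
  rewrite integral_sum//; last by move=> i; exact: gskip_int.
  under eq_bigr => i _ do rewrite (integral_comp_preserving (measurable_skip i)
    (fun A => measure_preimage_skip i prod) mg).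
  have /fineK <- := integrable_fin_num measurableT gint.
  rewrite sumEFin -EFinM sumr_const card_ord.
  by rewrite -[X in (_ * X)%R]mulr_natl mulrA mulVf ?mul1r// pnatr_eq0 -lt0n.
apply: ereal_inf_lbound; exists G => //; split.
- exact: measurable_int Gint.
- move=> w; rewrite leeNl; apply: le_ereal_inf_tmp => _ [s _ <-].
  (* The mean is expanded into leave-one-out means, and [gN s] is applied at each [skip i w]. *)
  rewrite -/(sample_mean (ft s) n w) -mean_sample_mean_skip// leeNl -EFinN.
  rewrite -mulrN -sumrN EFinM -sumEFin lee_pmul2l// ?lte_fin ?invr_gt0 ?ltr0n//.
  by apply: lee_sum => i _; rewrite EFinN; exact: gN.
- by left; exact: integral_funepos_lt_pinfty.
Qed.

End averages.

Theorem theorem2 (R : realType) (T : Type) (T_nonempty : inhabited T)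
    (Pt : T -> probability R R) (P : probability R R)
    (f : R -> R) (f_measurable : measurable_fun [set: R] f)
    (f_bounded_mean :
      ereal_sup [set 'E_(Pt t)[fun x => `|f x|%R] | t in [set: T]] < +oo)
    (ft : T -> R -> R)
    (ft_measurable : forall t, measurable_fun [set: R] (ft t))
    (ft_mean : forall t, 'E_P[ft t] = 'E_(Pt t)[f])
    (ft_abs_mean : forall t,
      'E_P[fun x => `|ft t x|%R] = 'E_(Pt t)[fun x => `|f x|%R])
    (Pinf : probability (seq_space R) R)
    (Pinf_product : is_infinite_product P Pinf)
    (inner_inf_finite :
      -oo < inner_expectation Pinf
              (fun w => ereal_inf [set (ft t (coordinate 1 w))%:E | t in [set: T]]))
    (n : nat) (n_ge2 : (2 <= n)%N) :
  [/\ inner_expectation Pinf (estimator ft n.-1)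
        <= inner_expectation Pinf (estimator ft n),
      inner_expectation Pinf (estimator ft n)
        <= outer_expectation Pinf (estimator ft n) &
      outer_expectation Pinf (estimator ft n) <= lower_expectation Pt f].
Proof.
have ft_integrable t : P.-integrable setT (EFin \o ft t).
  apply/integrableP; split; first exact/measurable_EFinP.
  have -> : \int[P]_x `|(EFin \o ft t) x| = 'E_P[fun x => `|ft t x|%R].
    by rewrite unlock.
  rewrite ft_abs_mean; apply: le_lt_trans f_bounded_mean.
  by apply: ereal_sup_ubound; exists t.
split.
(* One integrable [ft t] suffices to control the negative parts of all majorants. *)
- case: T_nonempty => t.
  exact: (inner_estimator_nondecreasing Pinf_product n_ge2 (ft_integrable t)).
- exact: inner_le_outer_expectation.
- apply: le_ereal_inf_tmp => _ [t _ <-]; rewrite -ft_mean.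
  by apply: (outer_estimator_le Pinf_product) => //; exact: ltnW.
Qed.
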